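(* Let $D\subset\mathbb{R}^n$ be a bounded domain of class $C^2$ with boundary $\partial D$, and let $$L=\sum_{i,j=1}^n a^{ij}(x)\partial_{ij}+\sum_{i=1}^n b^i(x)\partial_i+c(x)$$ be a second order degenerate elliptic operator in $D$, i.e. $\sum_{i,j=1}^n a^{ij}(x)\xi_i\xi_j\ge 0$ for all $\xi\in\mathbb{R}^n$ and $x\in D$, where $a^{ij},b^i,c$ are bounded and continuous functions (continuous up to the boundary, on $\bar D$). Let $P\in\partial D$ and suppose that in a neighborhood $U\subset\mathbb{R}^n$ of $P$ the boundary $\partial D$ has the form $\{x=(x_1,\dots,x_n): x_n-f(x_1,\dots,x_{n-1})=0\}$ with $f$ a $C^2$ function, and that $U\cap D$ lies in $\{x_n>f(x_1,\dots,x_{n-1})\}$. Let $\nu=\bigl(-\frac{\partial f}{\partial x_1},\dots,-\frac{\partial f}{\partial x_{n-1}},1\bigr)$, an interior normal vector to $\partial D$. Assume that $$-\sum_{i=1}^{n-1}b^i\frac{\partial f}{\partial x_i}+b^n-\sum_{i,j=1}^{n-1}a^{ij}\frac{\partial^2 f}{\partial x_i\partial x_j}>0\quad\text{at }P.$$ Let $u\in C^2(D)\cap C^1(\bar D)$. (1) Suppose $c=0$ in $U\cap\bar D$. If $u$ attains a strict minimum at $P$ and $Lu\le 0$ in $D$, then $\frac{\partial u}{\partial\nu}>0$ at $P$. If $u$ attains a strict maximum at $P$ and $Lu\ge 0$ in $D$, then $\frac{\partial u}{\partial\nu}<0$ at $P$. (2) Suppose instead that $c\le 0$ in $U\cap\bar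 D$. If $u$ attains a strict minimum at $P$, $Lu\le0$ in $D$ and $u(P)\le 0$, then $\frac{\partial u}{\partial\nu}>0$ at $P$. If $u$ attains a strict maximum at $P$, $Lu\ge0$ in $D$ and $u(P)\ge 0$, then $\frac{\partial u}{\partial\nu}<0$ at $P$.
   Context: $\partial_i=\partial/\partial x_i$, $\partial_{ij}=\partial^2/\partial x_i\partial x_j$. ''$u$ attains a strict minimum (maximum) at $P$'' means $u(x)>u(P)$ (respectively $u(x)<u(P)$) for all $x\in\bar D\setminus\{P\}$. $\frac{\partial u}{\partial\nu}(P)=\nu(P)\cdot Du(P)$, where $Du$ is the gradient of $u$, $\nu(P)$ is evaluated at $P$, and $\nu$ is not normalized. *)

(* Defs.v *)
From HB Require Import structures.
From mathcomp Require Export all_boot all_order all_algebra.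
From mathcomp Require Export all_classical all_reals all_analysis.
Export Order.TTheory GRing.Theory Num.Theory.
Export numFieldNormedType.Exports.

Set Implicit Arguments.
Unset Strict Implicit.
Unset Printing Implicit Defensive.

Local Open Scope classical_set_scope.
Local Open Scope ring_scope.

(* Points of R^n are row vectors.  When a last coordinate is needed, n = m.+1:
   x_n is [x 0 ord_max], the point (x_1, ..., x_(n-1)) is [col' ord_max x], and
   the index j < n-1 is [lift ord_max j].  All functions are total; only their
   values on the sets named in the hypotheses matter. *)

Definition partial (R : realType) (n : nat) (i : 'I_n) (u : 'rV[R]_n -> R)
    (x : 'rV[R]_n) : R :=
  'D_(delta_mx 0 i) u x.

Definition partial2 (R : realType) (n : nat) (i j : 'I_n) (u : 'rV[R]_n -> R)
    (x : 'rV[R]_n) : R :=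
  partial i (partial j u) x.

(* Meant for open O: all partial derivatives of order at most k exist and are
   continuous on O. *)
Fixpoint Ck_on (R : realType) (n k : nat) (O : set 'rV[R]_n)
    (u : 'rV[R]_n -> R) : Prop :=
  (forall x, O x -> {for x, continuous u}) /\
  match k with
  | 0%N => True
  | k'.+1 => forall i : 'I_n,
      (forall x, O x -> derivable u x (delta_mx 0 i)) /\
      Ck_on k' O (partial i u)
  end.

(* u is continuous on the closure of D, C^1 in D, and its first partial
   derivatives extend continuously from D to the closure of D. *)
Definition C1_closure (R : realType) (n : nat) (D : set 'rV[R]_n)
    (u : 'rV[R]_n -> R) : Prop :=
  [/\ Ck_on 1 D u,
      {within closure D, continuous u}
    & forall i : 'I_n, exists2 g : 'rV[R]_n -> R,
        {within closure D, continuous g} &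
        forall x, D x -> g x = partial i u x].

(* The gradient Du on the closure of D for u in C1_closure D: the value at x of
   the continuous extension of the partial derivatives, hence the usual
   gradient when x lies in D. *)
Definition grad_closure (R : realType) (n : nat) (D : set 'rV[R]_n)
    (u : 'rV[R]_n -> R) (x : 'rV[R]_n) : 'rV[R]_n :=
  \row_i lim (partial i u y @[y --> within D (nbhs x)]).

Definition dir_deriv (R : realType) (n : nat) (D : set 'rV[R]_n)
    (u : 'rV[R]_n -> R) (v x : 'rV[R]_n) : R :=
  \sum_(i < n) v 0 i * grad_closure D u x 0 i.

Definition boundary (T : topologicalType) (A : set T) : set T :=
  closure A `\` interior A.

Definition is_domain (R : realType) (n : nat) (D : set 'rV[R]_n) : Prop :=
  [/\ open D, connected D & D !=set0].

(* Near each boundary point, after relabeling (k) and reorienting (s) the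
   coordinate axes, D is the region above the graph of a C^2 function of the
   other coordinates. *)
Definition C2_boundary (R : realType) (m : nat) (D : set 'rV[R]_m.+1) : Prop :=
  forall Q, boundary D Q ->
  exists (U : set 'rV[R]_m.+1) (k : 'I_m.+1) (s : bool) (f : 'rV[R]_m -> R),
    [/\ open U, U Q, Ck_on 2 [set col' k x | x in U] f
      & forall x, U x -> (D x <-> f (col' k x) < (-1) ^+ s * x 0 k)].

Definition boundary_chart (R : realType) (m : nat) (D U : set 'rV[R]_m.+1)
    (f : 'rV[R]_m -> R) (P : 'rV[R]_m.+1) : Prop :=
  [/\ open U /\ U P,
      Ck_on 2 [set col' ord_max x | x in U] f,
      forall x, U x -> (boundary D x <-> x 0 ord_max - f (col' ord_max x) = 0)
    & forall x, U x -> D x -> f (col' ord_max x) < x 0 ord_max].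

Definition graph_normal (R : realType) (m : nat) (f : 'rV[R]_m -> R)
    (x : 'rV[R]_m.+1) : 'rV[R]_m.+1 :=
  \row_i (if unlift ord_max i is Some j then - partial j f (col' ord_max x)
          else 1).

Definition diff_op (R : realType) (n : nat)
    (a : 'I_n -> 'I_n -> 'rV[R]_n -> R) (b : 'I_n -> 'rV[R]_n -> R)
    (c : 'rV[R]_n -> R) (u : 'rV[R]_n -> R) (x : 'rV[R]_n) : R :=
  \sum_(i < n) \sum_(j < n) a i j x * partial2 i j u x
  + \sum_(i < n) b i x * partial i u x + c x * u x.

Definition degenerate_elliptic (R : realType) (n : nat) (D : set 'rV[R]_n)
    (a : 'I_n -> 'I_n -> 'rV[R]_n -> R) : Prop :=
  forall x, D x -> forall xi : 'rV[R]_n,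
    0 <= \sum_(i < n) \sum_(j < n) a i j x * xi 0 i * xi 0 j.

Definition bounded_continuous_on (R : realType) (n : nat) (A : set 'rV[R]_n)
    (g : 'rV[R]_n -> R) : Prop :=
  [bounded g x | x in A] /\ {within A, continuous g}.

Definition strict_min_at (R : realType) (n : nat) (D : set 'rV[R]_n)
    (u : 'rV[R]_n -> R) (P : 'rV[R]_n) : Prop :=
  forall x, closure D x -> x <> P -> u P < u x.

Definition strict_max_at (R : realType) (n : nat) (D : set 'rV[R]_n)
    (u : 'rV[R]_n -> R) (P : 'rV[R]_n) : Prop :=
  forall x, closure D x -> x <> P -> u x < u P.

(* Main.v *)
Require Import Defs.
From mathcomp Require Import ring lra.
Set Implicit Arguments.
Unset Strict Implicit.
Unset Printing Implicit Defensive.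
Local Open Scope classical_set_scope.
Local Open Scope ring_scope.

(** The proof compares [u] near [P] with a barrier, the height
    [h x = x_n - f x'] above the graph.  It vanishes on the boundary near [P],
    its gradient at [P] is the normal [nu], and the hypothesis at [P] says
    exactly that the principal and first order parts of [L] applied to [h] are
    positive at [P] ([operator_height]).  As [h P = 0], the zeroth order term
    does not change this, and by continuity [L h > 0] on the closure of [D]
    near [P].

    Let [P] be a strict minimum of [u], with [L u <= 0] in [D]; let [c <= 0] and
    [0 <= c * u P] near [P], which covers both [c = 0] and
    [c <= 0, u P <= 0].  On the part of the closure of [D] in a small ball
    around [P], put [w = u - e * h - u P].  On the boundary of [D] the height
    vanishes and [w >= 0] since [P] is a minimum; on the sphere [u - u P] is
    bounded below by a positive constant, because the minimum is strict, so
    [w >= 0] there once [e] is small.  At a negative interior minimum the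
    gradient of [w] vanishes and its Hessian is positive semidefinite, so that
    the second order part of [L w] is nonnegative, and so is [c * w]; but
    [L w < 0].  Hence [u >= u P + e * h] near [P] ([barrier_comparison]).
    Strictness of the minimum does the work that a strictly elliptic operator
    does in Hopf's lemma.

    Along the ray [P + t nu] the height grows like [t |nu|^2], so [u] grows at
    least like [e t |nu|^2]; the mean value theorem turns this into a lower
    bound on the derivative ([slope_at_boundary]).  That ray lies in [D]
    because the region above the graph near [P] is connected, meets [D], and
    misses the boundary of [D] ([domain_above_chart]).  The statements about
    maxima follow by passing to [- u].

    The sign of the second order part is a statement about matrices: the
    contraction of two positive semidefinite matrices is nonnegative as soon as
    one of them is symmetric ([psd_contraction_ge0]).  The matrix [a] is not
    assumed symmetric, so the symmetry must come from the Hessian, that is from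
    the equality of mixed partial derivatives ([partial2C]). *)

(** * Mean value estimates and symmetry of second derivatives *)

Lemma small_radius (R : realFieldType) (s d : R) :
  0 < s -> 0 < d -> exists r, [/\ 0 < r, r <= s & r < d].
Proof.
move=> s0 d0; exists (Num.min s (d / 2)); split.
- by rewrite lt_min s0 divr_gt0.
- by rewrite ge_min lexx.
- rewrite (@le_lt_trans _ _ (d / 2)) ?ge_min ?lexx ?orbT//.
  by rewrite ltr_pdivrMr// ltr_pMr// ltr1n.
Qed.

(** The increments determine the difference quotients, so no
    differentiability has to be known in advance: this is how derivatives pass
    through translations, restrictions to lines and forgotten coordinates. *)
Lemma is_derive_quotient (R : realType) (V W : normedModType R) (u : V -> R)
    (w : W -> R) (x v : V) (y z : W) :
  (forall h : R, u (h *: v + x) - u x = w (h *: z + y) - w y) ->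
  (derivable u x v <-> derivable w y z) /\ 'D_v u x = 'D_z w y.
Proof.
move=> E; rewrite /derivable /derive.
suff -> : (fun h : R => h^-1 *: ((u \o shift x) (h *: v) - u x)) =
  (fun h : R => h^-1 *: ((w \o shift y) (h *: z) - w y)) by [].
by apply/funext => h /=; rewrite E.
Qed.

Lemma is_derive_line (R : realType) (V : normedModType R) (u : V -> R)
    (x v : V) (t : R) :
  derivable u (x + t *: v) v ->
  is_derive t 1 (fun s => u (x + s *: v)) ('D_v u (x + t *: v)).
Proof.
have E (h : R) : u (x + (h *: 1 + t) *: v) - u (x + t *: v) =
    u (h *: v + (x + t *: v)) - u (x + t *: v).
  by rewrite [h *: 1]mulr1 scalerDl addrCA.
have [dE DE] := @is_derive_quotient R R^o V (fun s => u (x + s *: v)) u t 1 _ v E.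
by move=> du; split; [exact/dE|exact: DE].
Qed.

(** Mean value inequality in a form centred at a slope [p].  The
    point where the derivative is taken is not mentioned, which makes the
    estimate easy to iterate and to sum over coordinates. *)
Lemma mean_value_line (R : realType) (V : normedModType R) (u : V -> R)
    (x v : V) (s p e : R) :
  (forall t, `|t| <= `|s| -> derivable u (x + t *: v) v /\
     `|'D_v u (x + t *: v) - p| <= e) ->
  `|u (x + s *: v) - u x - s * p| <= e * `|s|.
Proof.
move=> H.
have mvt (l r : R) : l <= r -> `|l| <= `|s| -> `|r| <= `|s| ->
    exists2 t, `|t| <= `|s| &
      u (x + r *: v) - u (x + l *: v) = 'D_v u (x + t *: v) * (r - l).
  move=> lr ls rs.
  have Hs t : t \in `[l, r] -> `|t| <= `|s|.
    by rewrite in_itv/= => /andP[lt tr]; move: ls rs; rewrite !ler_norml; lra.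
  have [||t tlr ->] := @MVT_segment R (fun t => u (x + t *: v))
    (fun t => 'D_v u (x + t *: v)) _ _ lr.
  - by move=> t tlr; apply: is_derive_line; apply: (H t _).1;
      apply: Hs; exact: subset_itv_oo_cc.
  - by apply: derivable_within_continuous => t tlr;
      apply: ex_derive; apply: is_derive_line; apply: (H t _).1; exact: Hs.
  - by exists t => //; exact: Hs.
have bnd t d : `|t| <= `|s| -> d = 'D_v u (x + t *: v) * s ->
    `|d - s * p| <= e * `|s|.
  by move=> ts ->; rewrite [s * p]mulrC -mulrBl normrM ler_wpM2r// (H t ts).2.
have [s0|s0] := leP 0 s.
  have [|t ts E] := mvt 0 s s0 _ (lexx _); first by rewrite normr0.
  by apply: bnd ts _; rewrite -[in u x](addr0 x) -(scale0r v) E subr0.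
have [|t ts E] := mvt s 0 (ltW s0) (lexx _); first by rewrite normr0.
apply: bnd ts _; rewrite -[in u x](addr0 x) -(scale0r v) -opprB E sub0r.
by rewrite mulrN opprK.
Qed.

Lemma is_derive_translate (R : realType) (V : normedModType R) (u : V -> R)
    (x v w : V) :
  derivable u (x + w) v ->
  is_derive x v (fun y => u (y + w)) ('D_v u (x + w)).
Proof.
have E (h : R) : u (h *: v + x + w) - u (x + w) =
    u (h *: v + (x + w)) - u (x + w) by rewrite addrA.
have [dE DE] := @is_derive_quotient R V V (fun y => u (y + w)) u x v _ v E.
by move=> du; split; [exact/dE|exact: DE].
Qed.

(** The second difference is the increment along [v] of the
    increment of [u] along [w], so the mean value inequality applies twice. *)
Lemma second_difference (R : realType) (V : normedModType R) (u : V -> R)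
    (x v w : V) (s p e : R) :
  (forall t r, `|t| <= `|s| -> `|r| <= `|s| ->
     [/\ derivable u (x + t *: v + r *: w) v,
         derivable ('D_v u) (x + t *: v + r *: w) w
       & `|'D_w ('D_v u) (x + t *: v + r *: w) - p| <= e]) ->
  `|u (x + s *: v + s *: w) - u (x + s *: v) - u (x + s *: w) + u x
    - s * s * p| <= e * `|s| * `|s|.
Proof.
move=> H.
pose d y := u (y + s *: w) - u y.
rewrite [X in `|X|](_ : _ = d (x + s *: v) - d x - s * (s * p)); last first.
  by rewrite /d; ring.
apply: mean_value_line => t ts.
have N0 : `|0 : R| <= `|s| by rewrite normr0.
have [d1 _ _] := H t s ts (lexx _); have [d0 _ _] := H t 0 ts N0.
rewrite scale0r addr0 in d0.
have D : is_derive (x + t *: v) v (fun y => u (y + s *: w) - u y)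
    ('D_v u (x + t *: v + s *: w) - 'D_v u (x + t *: v)).
  apply: (@is_deriveB _ _ _ (fun y => u (y + s *: w)) u _ _
    ('D_v u (x + t *: v + s *: w))).
    by apply: is_derive_translate; exact: d1.
  exact: derivableP.
split; first exact: ex_derive.
rewrite (@derive_val _ _ _ _ _ _ _ D).
by apply: (@mean_value_line _ _ ('D_v u)) => r rs; have [] := H t r ts rs.
Qed.

Lemma Ck_on_continuous (R : realType) n k (O : set 'rV[R]_n)
    (u : 'rV[R]_n -> R) (x : 'rV[R]_n) :
  Ck_on k O u -> O x -> {for x, continuous u}.
Proof. by case: k => [|k] [cu _]; exact: cu. Qed.

Lemma Ck_on_pred (R : realType) n k (O : set 'rV[R]_n) (u : 'rV[R]_n -> R) :
  Ck_on k.+1 O u -> Ck_on k O u.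
Proof.
elim: k u => [|k IH] u [cu du]; split=> // i.
by have [dui cui] := du i; split=> //; exact: IH.
Qed.

Lemma Ck_on_sub (R : realType) n k (O O' : set 'rV[R]_n) (u : 'rV[R]_n -> R) :
  O' `<=` O -> Ck_on k O u -> Ck_on k O' u.
Proof.
move=> OO; elim: k u => [|k IH] u [cu du]; split=> //.
- by move=> x /OO; exact: cu.
- by move=> x /OO; exact: cu.
move=> i; have [dui cui] := du i; split; last exact: IH.
by move=> x /OO; exact: dui.
Qed.

Lemma Ck_on_near (R : realType) n (O : set 'rV[R]_n) (k : nat)
    (u : 'rV[R]_n -> R) (i : 'I_n) (x : 'rV[R]_n) :
  open O -> Ck_on k.+1 O u -> O x ->
  forall e, 0 < e -> \forall y \near x,
    [/\ O y, derivable u y (delta_mx 0 i)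
      & `|partial i u y - partial i u x| <= e].
Proof.
move=> oO [_ /(_ i) [du cu]] Ox e e0.
have cpu : {for x, continuous (partial i u)}.
  by case: k cu {du} => [|k] [+ _]; exact.
near=> y; split.
- by near: y; exact: open_nbhs_nbhs.
- by apply: du; near: y; exact: open_nbhs_nbhs.
- by near: y; apply: cvgr_distC_le.
Unshelve. all: by end_near. Qed.

(** The bounds are on [`|s|] and not [s] because this is the form of
    the hypothesis of [second_difference]. *)
Lemma small_plane (R : realType) (V : normedModType R) (v w x : V)
    (Q : set V) :
  (\forall y \near x, Q y) -> exists2 s : R, 0 < s &
  forall t r, `|t| <= `|s| -> `|r| <= `|s| -> Q (x + t *: v + r *: w).
Proof.
move=> /nbhs_normP[d /= d0 dQ].
have N0 : 0 < `|v| + `|w| + 1 by rewrite ltr_wpDl// addr_ge0.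
exists (d / (`|v| + `|w| + 1)); first by rewrite divr_gt0.
rewrite gtr0_norm ?divr_gt0// => t r ts rs; apply: dQ.
rewrite /ball_/= opprD addrA opprD addrA subrr sub0r -opprD normrN.
apply: (le_lt_trans (ler_normD _ _)); rewrite !normrZ.
apply: (@le_lt_trans _ _ (d / (`|v| + `|w| + 1) * (`|v| + `|w|))).
  by rewrite mulrDr lerD// ler_wpM2r.
by rewrite mulrAC ltr_pdivrMr// ltr_pM2l// ltrDl.
Qed.

(** Schwarz's theorem: the second difference is symmetric in [v] and
    [w], and divided by [s ^+ 2] it is close to each mixed derivative. *)
Lemma deriveC (R : realType) (V : normedModType R) (u : V -> R) (x v w : V) :
  (\forall y \near x, [/\ derivable u y v, derivable u y w,
     derivable ('D_v u) y w & derivable ('D_w u) y v]) ->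
  {for x, continuous ('D_w ('D_v u))} -> {for x, continuous ('D_v ('D_w u))} ->
  'D_w ('D_v u) x = 'D_v ('D_w u) x.
Proof.
move=> du cvw cwv; apply/eqP; rewrite -subr_eq0 -normr_le0.
suff H (e : R) : 0 < e -> `|'D_w ('D_v u) x - 'D_v ('D_w u) x| <= e.
  by apply/ler_addgt0Pr => e /H; rewrite add0r.
move=> e0.
have e20 : 0 < e / 2 by rewrite divr_gt0.
have bvw : \forall y \near x,
    `|'D_w ('D_v u) y - 'D_w ('D_v u) x| <= e / 2.
  by move/cvgrPdistC_le : cvw => /(_ _ e20).
have bwv : \forall y \near x,
    `|'D_v ('D_w u) y - 'D_v ('D_w u) x| <= e / 2.
  by move/cvgrPdistC_le : cwv => /(_ _ e20).
have [s s0 Hs] := small_plane v w (filterI du (filterI bvw bwv)).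
have A : `|u (x + s *: v + s *: w) - u (x + s *: v) - u (x + s *: w) + u x
    - s * s * 'D_w ('D_v u) x| <= e / 2 * `|s| * `|s|.
  apply: second_difference => t r ts rs.
  by have [[dv _ dvw _] [bvw' _]] := Hs t r ts rs; exact: And3 dv dvw bvw'.
have B : `|u (x + s *: w + s *: v) - u (x + s *: w) - u (x + s *: v) + u x
    - s * s * 'D_v ('D_w u) x| <= e / 2 * `|s| * `|s|.
  apply: second_difference => t r ts rs; rewrite addrAC.
  by have [[_ dw _ dwv] [_ bwv']] := Hs r t rs ts; exact: And3 dw dwv bwv'.
rewrite [x + _ + s *: v]addrAC in B; rewrite (gtr0_norm s0) in A B.
have ss : 0 < s * s by rewrite mulr_gt0.
rewrite -(ler_pM2r ss) -[X in `|_| * X](gtr0_norm ss) -normrM.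
rewrite [e * _](_ : _ = e / 2 * s * s + e / 2 * s * s); last by field.
apply: le_trans (lerD B A); apply: le_trans (ler_normB _ _).
move: ('D_w ('D_v u) x) ('D_v ('D_w u) x) => a b.
move: (u (x + s *: v + s *: w)) (u (x + s *: v)) (u (x + s *: w)) (u x).
move=> c1 c2 c3 c4; rewrite le_eqVlt; apply/orP; left; apply/eqP.
by congr `|_|; ring.
Qed.

Lemma partial2C (R : realType) n (O : set 'rV[R]_n) (u : 'rV[R]_n -> R)
    (i j : 'I_n) (x : 'rV[R]_n) :
  open O -> Ck_on 2 O u -> O x -> partial2 i j u x = partial2 j i u x.
Proof.
move=> oO [_ u2] Ox; have [duj [_ /(_ i)[duji [cuji _]]]] := u2 j.
have [dui [_ /(_ j)[duij [cuij _]]]] := u2 i.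
apply: deriveC; [|exact: cuji|exact: cuij].
have : \forall y \near x, O y by exact: open_nbhs_nbhs.
apply: filterS => y Oy.
by split; [exact: duj|exact: dui|exact: duji|exact: duij].
Qed.

(** * Necessary conditions at an interior minimum *)

(** Differentiability along a line as an affine approximation.
    Unlike the difference quotient this also makes sense at [h = 0], and it can
    be chained from one coordinate direction to the next. *)
Lemma is_derive_affineP (R : realType) (V : normedModType R) (u : V -> R)
    (x v : V) (l : R) :
  is_derive x v u l <->
  forall e, 0 < e ->
    \forall h \near (0 : R), `|u (x + h *: v) - u x - h * l| <= e * `|h|.
Proof.
have E (h : R) : h != 0 ->
    `|l - h^-1 * (u (h *: v + x) - u x)| * `|h| =
    `|u (x + h *: v) - u x - h * l|.
  move=> h0; rewrite -normrM -normrN [x + _]addrC; congr `|_|.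
  by move: (u _) (u _) => a b; field.
split=> [[du dl] e e0|H].
  have : h^-1 *: ((u \o shift x) (h *: v) - u x) @[h --> 0^'] --> l.
    by rewrite -dl; exact: du.
  move=> /cvgrPdist_le/(_ e e0); rewrite near_withinE.
  apply: filterS => h /= dh; have [->|h0] := eqVneq h 0.
    by rewrite scale0r addr0 subrr mul0r subr0 normr0 mulr0.
  by rewrite -E// ler_wpM2r//; exact: dh.
have cv : h^-1 *: ((u \o shift x) (h *: v) - u x) @[h --> 0^'] --> l.
  apply/cvgrPdist_le => e e0; rewrite near_withinE.
  near=> h => h0; rewrite -(ler_pM2r (_ : 0 < `|h|)) ?normr_gt0// E//.
  by near: h; exact: H.
by split; [apply/cvg_ex; exists l|apply/cvg_lim].
Unshelve. all: by end_near. Qed.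

(** A function with continuous partial derivatives is
    differentiable in every direction.  The direction is built up one coordinate
    at a time; each new coordinate contributes an increment that the mean value
    inequality controls, since the partial derivative is nearly constant. *)
Lemma is_derive_sum_partial (R : realType) n (O : set 'rV[R]_n)
    (u : 'rV[R]_n -> R) (x v : 'rV[R]_n) :
  open O -> Ck_on 1 O u -> O x ->
  is_derive x v u (\sum_(i < n) v 0 i * partial i u x).
Proof.
move=> oO u1 Ox; apply/is_derive_affineP.
suff: forall e : R, 0 < e -> \forall h \near (0 : R),
    `|u (x + h *: (\sum_(i < n) v 0 i *: delta_mx 0 i)) - u x
      - h * \sum_(i < n) v 0 i * partial i u x| <= e * `|h|.
  by rewrite -row_sum_delta.
apply: (big_rec2 (fun w l => forall e : R, 0 < e ->
    \forall h \near (0 : R), `|u (x + h *: w) - u x - h * l| <= e * `|h|)).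
  move=> e e0; apply: (@filterE R (nbhs (0 : R))) => h.
  by rewrite scaler0 addr0 subrr mulr0 subr0 normr0 mulr_ge0// ltW.
move=> i w l _ IH e e0.
set c := v 0 i; have c1 : 0 < `|c| + 1 by rewrite ltr_wpDl.
have e2 : 0 < e / 2 by rewrite divr_gt0.
(* The mean value inequality loses a factor `|c|, the length of the step. *)
have e3 : 0 < e / 2 / (`|c| + 1) by rewrite divr_gt0.
have [s s0 Hs] := small_plane w (delta_mx 0 i) (Ck_on_near i oO u1 Ox e3).
have sc : 0 < s / (`|c| + 1) by rewrite divr_gt0.
have sh : \forall h \near (0 : R), `|h| <= s / (`|c| + 1).
  exact: (@nbhs0_le _ R^o).
have := IH _ e2; apply: filterS2 sh => h hs B.
have hs1 : `|h| <= `|s|.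
  rewrite (gtr0_norm s0) (le_trans hs)// ler_pdivrMr// mulrDr mulr1 lerDr.
  by rewrite mulr_ge0// ltW.
have hcs : `|h * c| <= `|s|.
  rewrite normrM (gtr0_norm s0); move: hs; rewrite ler_pdivlMr// mulrDr mulr1.
  by apply: le_trans; rewrite lerDl.
have A : `|u (x + h *: w + (h * c) *: delta_mx 0 i) - u (x + h *: w)
    - h * c * partial i u x| <= e / 2 / (`|c| + 1) * `|h * c|.
  apply: mean_value_line => t th.
  by have [] := Hs h t hs1 (le_trans th hcs).
rewrite scalerDr [h *: (c *: _) + _]addrC addrA scalerA.
have C : e / 2 / (`|c| + 1) * `|h * c| <= e / 2 * `|h|.
  rewrite normrM mulrAC ler_pdivrMr// -[leRHS]mulrA (ler_wpM2l (ltW e2))//.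
  by rewrite ler_wpM2l// lerDl.
have -> : e * `|h| = e / 2 * `|h| + e / 2 * `|h| by move: `|h| => k; field.
apply: le_trans (lerD (le_trans A C) B).
apply: le_trans (ler_normD _ _).
rewrite le_eqVlt; apply/orP; left; apply/eqP; congr `|_|.
by move: (partial i u x) (u _) (u _) (u _) => p y1 y2 y3; ring.
Qed.

Lemma local_min_derive0 (R : realType) (V : normedModType R) (u : V -> R)
    (x v : V) (l : R) :
  is_derive x v u l -> (\forall h \near (0 : R), u x <= u (x + h *: v)) -> l = 0.
Proof.
move=> /is_derive_affineP du um; apply/eqP; rewrite -normr_le0.
suff H (e : R) : 0 < e -> `|l| <= e.
  by apply/ler_addgt0Pr => e /H; rewrite add0r.
move=> e0.
have /nbhs_normP[d /= d0 dH] : \forall h \near (0 : R),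
    u x <= u (x + h *: v) /\ `|u (x + h *: v) - u x - h * l| <= e * `|h|.
  by have := du _ e0; apply: filterS2 um.
have d20 : 0 < d / 2 by rewrite divr_gt0.
have dE : `|d / 2| = d / 2 by rewrite gtr0_norm.
have [|m1 b1] := dH (d / 2).
  by rewrite /ball_/= sub0r normrN dE ltr_pdivrMr// ltr_pMr// ltr1n.
have [|m2 b2] := dH (- (d / 2)).
  by rewrite /ball_/= sub0r opprK dE ltr_pdivrMr// ltr_pMr// ltr1n.
move: m1 b1 m2 b2; rewrite normrN dE.
move: (d / 2) d20 (u _) (u _) (u _) => k k0 y1 y0 y2 m1 b1 m2 b2.
rewrite -(ler_pM2r k0) -[X in `|_| * X](gtr0_norm k0) -normrM.
move: b1 b2; rewrite mulNr opprK [l * k]mulrC; move: (k * l) (e * k) => p q.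
by rewrite !ler_norml; lra.
Qed.

Lemma small_segment (R : realType) (V : normedModType R) (v x : V)
    (Q : set V) :
  (\forall y \near x, Q y) -> exists2 s : R, 0 < s &
  forall t, `|t| <= s -> Q (x + t *: v).
Proof.
move=> /(small_plane v 0)[s s0 Hs]; exists s => // t ts.
have := Hs t 0; rewrite scaler0 addr0 (gtr0_norm s0) normr0; apply => //.
exact: ltW.
Qed.

Lemma local_min_gradient0 (R : realType) n (O : set 'rV[R]_n)
    (u : 'rV[R]_n -> R) (x : 'rV[R]_n) (i : 'I_n) :
  Ck_on 1 O u -> O x -> (\forall y \near x, u x <= u y) -> partial i u x = 0.
Proof.
move=> [_ /(_ i)[du _]] Ox um.
apply: (@local_min_derive0 R _ u x (delta_mx 0 i)).
  exact: derivableP (du _ Ox).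
have [s s0 Hs] := small_segment (delta_mx 0 i) um.
have := @nbhs0_le _ R^o _ s0; exact: filterS.
Qed.

Lemma mean_value_derivable (R : realType) (g dg : R -> R) (a b : R) :
  a < b -> (forall t, t \in `[a, b]%R -> is_derive t 1 g (dg t)) ->
  exists2 t, a < t < b & g b - g a = dg t * (b - a).
Proof.
move=> ab dr.
have dro (t : R) : t \in `]a, b[%R -> is_derive t 1 g (dg t).
  by move=> /subset_itv_oo_cc/dr.
have cg : {within `[a, b], continuous g}.
  by apply: derivable_within_continuous => t /dr[].
have [t tr E] := MVT ab dro cg.
by exists t; [move: tr; rewrite in_itv|].
Qed.

(** If the second derivative along [v] were negative, the
    first derivative along [v], which vanishes at [x], would be negative just
    after [x], and [u] would drop below its minimum. *)
Lemma local_min_hessian_ge0 (R : realType) n (O : set 'rV[R]_n)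
    (u : 'rV[R]_n -> R) (x v : 'rV[R]_n) :
  open O -> Ck_on 2 O u -> O x -> (\forall y \near x, u x <= u y) ->
  0 <= \sum_(i < n) \sum_(j < n) partial2 i j u x * v 0 i * v 0 j.
Proof.
move=> oO u2 Ox um.
have u1 := Ck_on_pred u2.
pose W y := \sum_(i < n) v 0 i * partial i u y.
set L := \sum_i _.
have dW : is_derive x v W L.
  have -> : W = \sum_(i < n) (v 0 i \*: partial i u).
    by apply/funext => y; rewrite fct_sumE.
  have -> : L = \sum_(j < n) v 0 j *: \sum_(i < n) v 0 i * partial2 i j u x.
    rewrite /L exchange_big; apply: eq_bigr => j _ /=.
    rewrite scaler_sumr; apply: eq_bigr => i _.
    by rewrite -[RHS]/(_ * (_ * _)); ring.
  apply: is_derive_sum => j; apply: is_deriveZ.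
  apply: is_derive_sum_partial oO _ Ox.
  by have [_ /(_ j)[]] := u2.
have W0 : W x = 0.
  by rewrite /W big1// => i _; rewrite (local_min_gradient0 i u1 Ox um) mulr0.
rewrite leNgt; apply/negP => L0.
have L20 : 0 < - L / 2 by rewrite divr_gt0// oppr_gt0.
have /nbhs_normP[d /= d0 Hd] : \forall h \near (0 : R),
    `|W (x + h *: v) - W x - h * L| <= - L / 2 * `|h|.
  by move/is_derive_affineP : dW; exact.
have [s s0 Hs] := small_segment v
  (filterI um (open_nbhs_nbhs (conj oO Ox))).
have [r [r0 rs rd]] := small_radius s0 d0.
pose g (t : R) := u (x + t *: v); pose dg (t : R) := W (x + t *: v).
have dr (t : R) : t \in `[0, r]%R -> is_derive t 1 g (dg t).
  rewrite in_itv/= => /andP[t0 tr].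
  have [_ Ot] : u x <= u (x + t *: v) /\ O (x + t *: v).
    by apply: Hs; rewrite ger0_norm// (le_trans tr).
  have [dx dE] := is_derive_sum_partial v oO u1 Ot.
  have -> : dg t = 'D_v u (x + t *: v) by rewrite dE.
  exact: is_derive_line dx.
have [t tr E] := mean_value_derivable r0 dr.
rewrite /g /dg in E.
have [ur _] : u x <= u (x + r *: v) /\ O (x + r *: v).
  by apply: Hs; rewrite gtr0_norm.
move/andP: tr => [t0 tr].
have := Hd t; rewrite /ball_/= sub0r normrN gtr0_norm// => /(_ (lt_trans tr rd)).
rewrite W0 subr0 ler_norml => /andP[_ Wt].
have Wt0 : W (x + t *: v) < 0.
  have : t * L < 0 by rewrite pmulr_rlt0.
  move: Wt; rewrite mulrAC mulNr [L * t]mulrC; lra.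
move: E; rewrite scale0r addr0 subr0 => E.
have : W (x + t *: v) * r < 0 by rewrite pmulr_llt0.
by rewrite -E ltNge subr_ge0 ur.
Qed.

(** * Contraction of two positive semidefinite matrices *)

Definition bilin (R : realType) n (A : 'M[R]_n) (x y : 'rV[R]_n) : R :=
  (x *m A *m y^T) 0 0.

Lemma bilinDZl (R : realType) n (A : 'M[R]_n) (x y z : 'rV[R]_n) t :
  bilin A (x + t *: y) z = bilin A x z + t * bilin A y z.
Proof. by rewrite /bilin mulmxDl mulmxDl -!scalemxAl !mxE. Qed.

Lemma bilinC (R : realType) n (A : 'M[R]_n) (x y : 'rV[R]_n) :
  A^T = A -> bilin A x y = bilin A y x.
Proof.
move=> As; rewrite /bilin.
have -> : x *m A *m y^T = (y *m A *m x^T)^T by rewrite !trmx_mul trmxK As mulmxA.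
by rewrite mxE.
Qed.

Lemma bilin_sq (R : realType) n (A : 'M[R]_n) (x y : 'rV[R]_n) t :
  A^T = A -> bilin A (x + t *: y) (x + t *: y) =
  bilin A x x + 2 * t * bilin A y x + t * t * bilin A y y.
Proof.
move=> As; rewrite bilinDZl ![bilin A _ (x + _)]bilinC// !bilinDZl.
by rewrite [bilin A x y]bilinC//; ring.
Qed.

Lemma bilinE (R : realType) n (A : 'M[R]_n) (x : 'rV[R]_n) :
  bilin A x x = \sum_(i < n) \sum_(j < n) A i j * x 0 i * x 0 j.
Proof.
rewrite /bilin mxE exchange_big; apply: eq_bigr => j _.
rewrite !mxE mulr_suml; apply: eq_bigr => i _.
by rewrite [x 0 i * _]mulrC.
Qed.

Lemma bilin_delta (R : realType) n (A : 'M[R]_n) (i j : 'I_n) :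
  bilin A (delta_mx 0 i) (delta_mx 0 j) = A i j.
Proof. by rewrite /bilin -rowE trmx_delta -colE !mxE. Qed.

Lemma bilin_deltal (R : realType) n (A : 'M[R]_n) (i : 'I_n) (x : 'rV[R]_n) :
  bilin A (delta_mx 0 i) x = \sum_(j < n) A i j * x 0 j.
Proof. by rewrite /bilin -rowE mxE; apply: eq_bigr => j _; rewrite !mxE. Qed.

(** A symmetric positive semidefinite [H] is a sum of squares of
    linear forms, and contracting [A] with one such square evaluates the
    quadratic form of [A].  The squares are split off by Gaussian elimination,
    the induction being on the number of rows not yet cleared. *)
Lemma psd_contraction_ge0 (R : realType) n (A H : 'M[R]_n) :
  (forall x, 0 <= bilin A x x) -> H^T = H -> (forall x, 0 <= bilin H x x) ->
  0 <= \sum_(i < n) \sum_(j < n) A i j * H i j.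
Proof.
move=> A0.
suff S k : forall H : 'M[R]_n, (forall i j : 'I_n, (k <= i)%N -> H i j = 0) ->
    H^T = H -> (forall x, 0 <= bilin H x x) ->
    0 <= \sum_(i < n) \sum_(j < n) A i j * H i j.
  by apply: (S n) => i j; rewrite leqNgt ltn_ord.
elim: k => [|k IH] {}H Hk Hs Hp.
  by rewrite big1// => i _; rewrite big1// => j _; rewrite Hk// mulr0.
have [nk|kn] := leqP n k.
  by apply: IH => // i j ki; have := leq_trans nk ki; rewrite leqNgt ltn_ord.
pose r := Ordinal kn.
have HC i j : H i j = H j i by rewrite -[in LHS]Hs mxE.
have Hrr : 0 <= H r r by rewrite -bilin_delta.
have [Hrr0|Hrr_neq0] := eqVneq (H r r) 0.
  apply: IH => // i j; rewrite leq_eqVlt => /predU1P[ki|]; last exact: Hk.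
  have -> : i = r by exact: val_inj.
  apply/eqP/negPn/negP => Hrj.
  (* With H r r = 0 the form is affine in the multiple of the r-th basis
     vector; this multiple makes its value -1. *)
  have := Hp (delta_mx 0 j + (- (H j j + 1) / (2 * H r j)) *: delta_mx 0 r).
  rewrite bilin_sq// !bilin_delta Hrr0 mulr0 addr0.
  rewrite [X in _ + X](_ : _ = - (H j j + 1)); last by field.
  by lra.
have {Hrr}Hrr_gt0 : 0 < H r r by rewrite lt_neqAle eq_sym Hrr_neq0.
(* Schur complement: K has one more zero row than H, and H - K is the square
   of a linear form. *)
pose K : 'M[R]_n := \matrix_(i, j) (H i j - H r i * H r j / H r r).
have KE x : bilin K x x = bilin H x x - bilin H (delta_mx 0 r) x ^+ 2 / H r r.
  rewrite !bilinE bilin_deltal expr2 mulr_suml mulr_suml -sumrB.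
  apply: eq_bigr => i _; rewrite mulr_sumr mulr_suml -sumrB.
  by apply: eq_bigr => j _; rewrite mxE; field.
have K0 : 0 <= \sum_(i < n) \sum_(j < n) A i j * K i j.
  apply: IH.
  - move=> i j; rewrite mxE leq_eqVlt => /predU1P[ki|ki].
      have -> : i = r by exact: val_inj.
      by field.
    by rewrite Hk// HC Hk//; ring.
  - by apply/matrixP => i j; rewrite !mxE HC; congr (_ - _); ring.
  - move=> x; rewrite KE.
    (* The form of K at x is the minimum of the form of H on the line through
       x in the r-th direction; this is the minimizer. *)
    have := Hp (x + (- bilin H (delta_mx 0 r) x / H r r) *: delta_mx 0 r).
    rewrite bilin_sq// bilin_delta; move: (bilin _ _ _) (bilin _ _ _) => a b.
    by rewrite [X in 0 <= X -> _](_ : _ = b - a ^+ 2 / H r r)//; field.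
have -> : \sum_(i < n) \sum_(j < n) A i j * H i j =
    \sum_(i < n) \sum_(j < n) A i j * K i j + bilin A (row r H) (row r H) / H r r.
  rewrite bilinE mulr_suml -big_split; apply: eq_bigr => i _.
  rewrite mulr_suml -big_split; apply: eq_bigr => j _ /=.
  by rewrite !mxE; field.
by rewrite addr_ge0// divr_ge0// ltW.
Qed.

(** * Linear combinations and functions of fewer variables *)

Lemma open_eq_near (T : topologicalType) (R : Type) (O : set T) (u v : T -> R)
    (x : T) :
  open O -> O x -> (forall y, O y -> u y = v y) -> \forall y \near x, u y = v y.
Proof.
move=> oO Ox uv; have : \forall y \near x, O y by exact: open_nbhs_nbhs.
exact: filterS.
Qed.

Lemma near_eq_continuous (T U : topologicalType) (u v : T -> U) (x : T) :
  (\forall y \near x, u y = v y) -> {for x, continuous u} ->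
  {for x, continuous v}.
Proof.
move=> uv; rewrite /prop_for /continuous_at (nbhs_singleton uv).
by apply: cvg_trans; exact: near_eq_cvg.
Qed.

Lemma Ck_on_ext (R : realType) n k (O : set 'rV[R]_n) (u v : 'rV[R]_n -> R) :
  open O -> (forall x, O x -> u x = v x) -> Ck_on k O u -> Ck_on k O v.
Proof.
move=> oO; elim: k u v => [|k IH] u v uv [cu du]; split=> //;
  do ?by move=> x Ox; apply: near_eq_continuous (cu x Ox);
         exact: (open_eq_near oO Ox uv).
move=> i; have [dui cui] := du i; split.
  move=> x Ox; apply: near_eq_derivable (dui x Ox).
  exact: (open_eq_near oO Ox uv).
apply: IH cui => x Ox; apply: near_eq_derive; exact: (open_eq_near oO Ox uv).
Qed.

(** The combinations [p * u + q * v + s] include the comparison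
    function [u - e * h - u P], the height above a graph, and [- u]. *)
Lemma is_derive_lin (R : realType) (V : normedModType R) (u v : V -> R)
    (p q s : R) (x w : V) :
  derivable u x w -> derivable v x w ->
  is_derive x w (fun y => p * u y + q * v y + s)
    (p * 'D_w u x + q * 'D_w v x).
Proof.
move=> /derivableP du /derivableP dv.
have -> : (fun y => p * u y + q * v y + s) = (p \*: u) + (q \*: v) + cst s.
  by apply/funext.
rewrite -[X in is_derive _ _ _ X]addr0.
by apply: is_deriveD; apply: is_deriveD; apply: is_deriveZ.
Qed.

Lemma continuous_lin (R : realType) (V : topologicalType) (u v : V -> R)
    (p q s : R) (x : V) :
  {for x, continuous u} -> {for x, continuous v} ->
  {for x, continuous (fun y => p * u y + q * v y + s)}.
Proof.
move=> cu cv.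
apply: (@continuousD _ R^o).
  apply: (@continuousD _ R^o); apply: (@continuousM R); try exact: cst_continuous.
    exact: cu.
  exact: cv.
exact: cst_continuous.
Qed.

Lemma Ck_on_lin (R : realType) n k (O : set 'rV[R]_n) (u v : 'rV[R]_n -> R)
    (p q s : R) :
  open O -> Ck_on k O u -> Ck_on k O v ->
  Ck_on k O (fun x => p * u x + q * v x + s).
Proof.
move=> oO; elim: k u v s => [|k IH] u v s Cu Cv.
  split=> // x Ox; apply: continuous_lin.
    exact: (Ck_on_continuous Cu Ox).
  exact: (Ck_on_continuous Cv Ox).
split.
  move=> x Ox; apply: continuous_lin.
    exact: (Ck_on_continuous Cu Ox).
  exact: (Ck_on_continuous Cv Ox).
move=> i; have [[_ /(_ i)[du cu]] [_ /(_ i)[dv cv]]] := (Cu, Cv).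
have D x : O x -> is_derive x (delta_mx 0 i : 'rV[R]_n)
   (fun y => p * u y + q * v y + s) (p * partial i u x + q * partial i v x).
  by move=> Ox; apply: is_derive_lin; [exact: du|exact: dv].
split; first by move=> x /D ?; exact: ex_derive.
apply: Ck_on_ext (IH _ _ 0 cu cv) => // x /D ?.
by rewrite addr0 /partial derive_val.
Qed.

Lemma partial_lin (R : realType) n (O : set 'rV[R]_n) (u v : 'rV[R]_n -> R)
    (p q s : R) (i : 'I_n) (x : 'rV[R]_n) :
  Ck_on 1 O u -> Ck_on 1 O v -> O x ->
  partial i (fun y => p * u y + q * v y + s) x =
  p * partial i u x + q * partial i v x.
Proof.
move=> [_ /(_ i)[du _]] [_ /(_ i)[dv _]] Ox.
have ? := is_derive_lin p q s (du x Ox) (dv x Ox).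
by rewrite /partial derive_val.
Qed.

Lemma partial2_lin (R : realType) n (O : set 'rV[R]_n) (u v : 'rV[R]_n -> R)
    (p q s : R) (i j : 'I_n) (x : 'rV[R]_n) :
  open O -> Ck_on 2 O u -> Ck_on 2 O v -> O x ->
  partial2 i j (fun y => p * u y + q * v y + s) x =
  p * partial2 i j u x + q * partial2 i j v x.
Proof.
move=> oO Cu Cv Ox.
have [[_ /(_ j)[_ Cu1]] [_ /(_ j)[_ Cv1]]] := (Cu, Cv).
rewrite -(partial_lin p q 0 i Cu1 Cv1 Ox).
apply: near_eq_derive; apply: open_eq_near Ox _ => // y Oy.
by rewrite addr0; apply: partial_lin Oy; exact: Ck_on_pred.
Qed.

Lemma col'_continuous (R : realType) m (k : 'I_m.+1) :
  continuous (col' k : 'rV[R]_m.+1 -> 'rV[R]_m).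
Proof.
move=> x A /nbhs_ballP[e /= e0 eA]; apply/nbhs_ballP; exists e => //= y [_ xy].
by apply: eA; split=> // i j; rewrite !mxE.
Qed.

Lemma col'_lift (R : realType) m (k : 'I_m.+1) (j : 'I_m) (h : R)
    (x : 'rV[R]_m.+1) :
  col' k (h *: delta_mx 0 (lift k j) + x) = h *: delta_mx 0 j + col' k x.
Proof.
by apply/rowP => i; rewrite !mxE /= (inj_eq (@lift_inj _ k)).
Qed.

Lemma col'_id (R : realType) m (k : 'I_m.+1) (h : R) (x : 'rV[R]_m.+1) :
  col' k (h *: delta_mx 0 k + x) = col' k x.
Proof.
apply/rowP => i; rewrite !mxE /= [lift k i == k]eq_sym (negPf (neq_lift k i)).
by rewrite mulr0 add0r.
Qed.

Lemma derive_col'_lift (R : realType) m (k : 'I_m.+1) (f : 'rV[R]_m -> R)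
    (j : 'I_m) (x : 'rV[R]_m.+1) :
  (derivable (fun x => f (col' k x)) x (delta_mx 0 (lift k j)) <->
     derivable f (col' k x) (delta_mx 0 j)) /\
  partial (lift k j) (fun x => f (col' k x)) x = partial j f (col' k x).
Proof. by apply: is_derive_quotient => h; rewrite col'_lift. Qed.

Lemma is_derive_col'_id (R : realType) m (k : 'I_m.+1) (f : 'rV[R]_m -> R)
    (x : 'rV[R]_m.+1) :
  is_derive x (delta_mx 0 k : 'rV[R]_m.+1) (fun x => f (col' k x)) 0.
Proof.
pose z : 'rV[R]_m.+1 -> R := cst 0.
have E (h : R) : f (col' k (h *: delta_mx 0 k + x)) - f (col' k x) =
    z (h *: delta_mx 0 k + x) - z x by rewrite col'_id !subrr.
have [dE DE] := @is_derive_quotient R _ _ (fun x => f (col' k x)) z x _ x _ E.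
by split; [apply/dE; exact: derivable_cst|rewrite DE derive_cst].
Qed.

Lemma partial_col'_lift (R : realType) m (k : 'I_m.+1) (f : 'rV[R]_m -> R)
    (j : 'I_m) :
  partial (lift k j) (fun x => f (col' k x)) = fun x => partial j f (col' k x).
Proof. by apply/funext => x; exact: (derive_col'_lift k f j x).2. Qed.

Lemma partial_col'_id (R : realType) m (k : 'I_m.+1) (f : 'rV[R]_m -> R) :
  partial k (fun x => f (col' k x)) = cst 0.
Proof. by apply/funext => x; have [] := is_derive_col'_id k f x. Qed.

Lemma Ck_on_cst (R : realType) n k (O : set 'rV[R]_n) (s : R) :
  Ck_on k O (cst s).
Proof.
elim: k s => [|k IH] s; split=> //; do ?by move=> x _; exact: cst_continuous.
move=> i; split=> [x _|]; first exact: derivable_cst.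
have -> : partial i (cst s) = cst 0; last exact: IH.
by apply/funext => x; exact: derive_cst.
Qed.

(** A function of the remaining coordinates has, at every point, the
    same difference quotients as the function it comes from, so that derivatives
    of all orders transfer as equalities of functions. *)
Lemma Ck_on_col' (R : realType) m n (k : 'I_m.+1) (U : set 'rV[R]_m.+1)
    (f : 'rV[R]_m -> R) :
  Ck_on n [set col' k x | x in U] f -> Ck_on n U (fun x => f (col' k x)).
Proof.
elim: n f => [|n IH] f [cf df]; split=> //.
- move=> x Ux; apply: continuous_comp; first exact: col'_continuous.
  by apply: cf; exists x.
- move=> x Ux; apply: continuous_comp; first exact: col'_continuous.
  by apply: cf; exists x.
move=> i; case: (unliftP k i) => [j ->|->].
  have [dfj cfj] := df j; split.
    by move=> x Ux; apply/(derive_col'_lift k f j x).1; apply: dfj; exists x.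
  by rewrite partial_col'_lift; exact: IH.
split; first by move=> x _; have [] := is_derive_col'_id k f x.
by rewrite partial_col'_id; exact: Ck_on_cst.
Qed.

Lemma is_derive_coord (R : realType) n (i k : 'I_n) (x : 'rV[R]_n) :
  is_derive x (delta_mx 0 i : 'rV[R]_n) (fun x : 'rV[R]_n => x 0 k) (i == k)%:R.
Proof.
apply/is_derive_affineP => e e0; apply: (@filterE R (nbhs (0 : R))) => h.
rewrite !mxE eqxx /= [k == i]eq_sym [X in `|X|](_ : _ = 0); last by ring.
by rewrite normr0 mulr_ge0// ltW.
Qed.

Lemma partial_coord (R : realType) n (i k : 'I_n) :
  partial i (fun x : 'rV[R]_n => x 0 k) = cst (i == k)%:R.
Proof. by apply/funext => x; have [] := is_derive_coord i k x. Qed.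

Lemma Ck_on_coord (R : realType) n l (k : 'I_n) (O : set 'rV[R]_n) :
  Ck_on l O (fun x : 'rV[R]_n => x 0 k).
Proof.
have c : continuous (fun x : 'rV[R]_n => x 0 k) by exact: coord_continuous.
case: l => [|l]; split=> //; do ?by move=> x _; exact: c.
move=> i; rewrite partial_coord; split; last exact: Ck_on_cst.
by move=> x _; have [] := is_derive_coord i k x.
Qed.

Lemma diff_op_lin (R : realType) n (O : set 'rV[R]_n)
    (a : 'I_n -> 'I_n -> 'rV[R]_n -> R) (b : 'I_n -> 'rV[R]_n -> R)
    (c : 'rV[R]_n -> R) (u v : 'rV[R]_n -> R) (p q s : R) (x : 'rV[R]_n) :
  open O -> Ck_on 2 O u -> Ck_on 2 O v -> O x ->
  diff_op a b c (fun y => p * u y + q * v y + s) x =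
  p * diff_op a b c u x + q * diff_op a b c v x + c x * s.
Proof.
move=> oO u2 v2 Ox.
have sum_lin (F G H : 'I_n -> R) : (forall i, F i = p * G i + q * H i) ->
    \sum_i F i = p * \sum_i G i + q * \sum_i H i.
  by move=> E; rewrite !mulr_sumr -big_split; apply: eq_bigr => i _; exact: E.
have mul_lin (k y y1 y2 : R) : y = p * y1 + q * y2 ->
    k * y = p * (k * y1) + q * (k * y2) by move=> ->; ring.
have op_lin (S S1 S2 T T1 T2 k z z1 z2 : R) :
    S = p * S1 + q * S2 -> T = p * T1 + q * T2 -> z = p * z1 + q * z2 + s ->
    S + T + k * z = p * (S1 + T1 + k * z1) + q * (S2 + T2 + k * z2) + k * s.
  by move=> -> -> ->; ring.
apply: op_lin => //; apply: (sum_lin) => i.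
  by apply: (sum_lin) => j; apply: mul_lin; exact: partial2_lin oO u2 v2 Ox.
by apply: mul_lin; exact: partial_lin (Ck_on_pred u2) (Ck_on_pred v2) Ox.
Qed.

(** * The height above a graph *)

Lemma sum_ord_max (R : realType) m (F : 'I_m.+1 -> R) :
  \sum_(i < m.+1) F i = F ord_max + \sum_(i < m) F (lift ord_max i).
Proof. by rewrite (bigD1_ord ord_max). Qed.

Definition height (R : realType) m (f : 'rV[R]_m -> R) (x : 'rV[R]_m.+1) : R :=
  x 0 ord_max - f (col' ord_max x).

Section Height.
Variables (R : realType) (m : nat) (U : set 'rV[R]_m.+1) (f : 'rV[R]_m -> R).
Hypotheses (oU : open U) (f2 : Ck_on 2 [set col' ord_max x | x in U] f).

Lemma height_lin :
  height f = fun x => 1 * x 0 ord_max + - 1 * f (col' ord_max x) + 0.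
Proof. by apply/funext => x; rewrite /height; ring. Qed.

Lemma Ck_on_height : Ck_on 2 U (height f).
Proof.
rewrite height_lin; apply: Ck_on_lin => //; first exact: Ck_on_coord.
exact: Ck_on_col'.
Qed.

Lemma partial_height x i : U x -> partial i (height f) x = graph_normal f x 0 i.
Proof.
move=> Ux; have F1 := Ck_on_pred (Ck_on_col' f2).
rewrite height_lin (partial_lin _ _ _ _ (Ck_on_coord 1 ord_max U) F1 Ux) mxE.
rewrite partial_coord; case: unliftP => [j ->|->].
  rewrite partial_col'_lift /= [_ == _]eq_sym (negPf (neq_lift _ _)).
  by rewrite mulr0 add0r mulN1r.
by rewrite (partial_col'_id ord_max f) /= eqxx mulr0 addr0 mulr1.
Qed.

Lemma partial2_height x i j : U x -> partial2 i j (height f) x =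
  if unlift ord_max i is Some i' then
    if unlift ord_max j is Some j' then - partial2 i' j' f (col' ord_max x)
    else 0
  else 0.
Proof.
move=> Ux; have F2 := Ck_on_col' f2.
rewrite height_lin (partial2_lin _ _ _ _ _ oU (Ck_on_coord 2 ord_max U) F2 Ux).
rewrite /partial2 partial_coord {1}/partial derive_cst.
rewrite mulr0 add0r mulN1r.
case: (unliftP ord_max j) => [j' ->|->].
  rewrite partial_col'_lift; case: (unliftP ord_max i) => [i' ->|->].
    by rewrite partial_col'_lift.
  by rewrite (partial_col'_id ord_max (partial j' f)) oppr0.
rewrite (partial_col'_id ord_max f) /partial derive_cst oppr0.
by case: unliftP.
Qed.

(** The quantity assumed positive at [P] is the operator without
    its zeroth order term, applied to the height. *)
Lemma operator_height (a : 'I_m.+1 -> 'I_m.+1 -> R) (b : 'I_m.+1 -> R) x : U x ->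
  \sum_i \sum_j a i j * partial2 i j (height f) x
    + \sum_i b i * partial i (height f) x =
  - (\sum_(i < m) b (lift ord_max i) * partial i f (col' ord_max x)) + b ord_max
    - \sum_(i < m) \sum_(j < m) a (lift ord_max i) (lift ord_max j)
        * partial2 i j f (col' ord_max x).
Proof.
move=> Ux; rewrite addrC.
have -> : \sum_i b i * partial i (height f) x =
    - (\sum_(i < m) b (lift ord_max i) * partial i f (col' ord_max x))
    + b ord_max.
  rewrite sum_ord_max partial_height// mxE unlift_none mulr1 addrC; congr (_ + _).
  rewrite -sumrN; apply: eq_bigr => i _.
  by rewrite partial_height// mxE liftK mulrN.
set S2 := \sum_i \sum_j _; set T2 := \sum_(i < m) \sum_(j < m) _.
suff -> : S2 = - T2 by [].
have row i : \sum_j a i j * partial2 i j (height f) x =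
    if unlift ord_max i is Some i' then
      - \sum_(j < m) a (lift ord_max i') (lift ord_max j)
        * partial2 i' j f (col' ord_max x)
    else 0.
  case: (unliftP ord_max i) => [i' ->|->].
    rewrite sum_ord_max partial2_height// unlift_none liftK mulr0 add0r -sumrN.
    by apply: eq_bigr => j _; rewrite partial2_height// !liftK mulrN.
  by apply: big1 => j _; rewrite partial2_height// unlift_none mulr0.
rewrite /S2 (eq_bigr _ (fun i _ => row i)).
rewrite sum_ord_max unlift_none add0r /T2 -sumrN.
by apply: eq_bigr => i _; rewrite liftK.
Qed.

End Height.

(** * The domain fills the chart above the graph *)

(** Inside [A] the set [D] coincides with its closure, so it is both
    open and closed there. *)
Lemma connected_sub_open (T : topologicalType) (A D : set T) :
  open D -> connected A -> A `&` boundary D = set0 -> A `&` D !=set0 ->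
  A `<=` D.
Proof.
move=> oD cA AD AD0; suff <- : A `&` D = A by exact: subIsetr.
apply: cA => //; first by exists D.
exists (closure D); first exact: closed_closure.
apply/seteqP; split=> x [Ax Dx]; split=> //; first exact: subset_closure.
apply: contrapT => nDx; suff : (A `&` boundary D) x by rewrite AD.
by split=> //; split=> //; rewrite ((interior_id D).1 oD).
Qed.

Lemma conv_lt (R : realDomainType) (a b c t : R) :
  0 <= t -> t <= 1 -> a < c -> b < c -> a + t * (b - a) < c.
Proof.
move=> t0 t1 ac bc; have [ab|ba] := leP a b.
  apply: le_lt_trans bc; rewrite -[leRHS](subrKC a) lerD2l.
  by rewrite ler_piMl// subr_ge0.
apply: le_lt_trans ac; rewrite -[leRHS]addr0 lerD2l.
by rewrite mulr_ge0_le0// subr_le0 ltW.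
Qed.

Lemma conv_dist_lt (R : realDomainType) (p a b c t : R) :
  0 <= t -> t <= 1 -> `|p - a| < c -> `|p - b| < c ->
  `|p - (a + t * (b - a))| < c.
Proof.
move=> t0 t1; rewrite !ltr_norml => /andP[a1 a2] /andP[b1 b2].
have := @conv_lt R _ _ _ t t0 t1 a2 b2.
have a1' : - (p - a) < c by lra.
have b1' : - (p - b) < c by lra.
have := @conv_lt R _ _ _ t t0 t1 a1' b1'.
by rewrite ![t * _]mulrBr ?mulrN !mulrBr => *; apply/andP; split; lra.
Qed.

Section Shear.
Variables (R : realType) (m : nat) (f : 'rV[R]_m -> R).
Implicit Types x y z : 'rV[R]_m.+1.

(** Straightens the graph: the points of positive height are the images of
    those with positive last coordinate, so that segments can be used to connect
    points above the graph. *)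
Definition shear z : 'rV[R]_m.+1 := z + f (col' ord_max z) *: delta_mx 0 ord_max.

Lemma col'_shear z : col' ord_max (shear z) = col' ord_max z.
Proof. by rewrite /shear addrC col'_id. Qed.

Lemma shear_last z : shear z 0 ord_max = z 0 ord_max + f (col' ord_max z).
Proof. by rewrite /shear !mxE !eqxx mulr1. Qed.

Lemma height_shear z : height f (shear z) = z 0 ord_max.
Proof. by rewrite /height col'_shear shear_last addrK. Qed.

Lemma shear_onto x : exists z, [/\ shear z = x, col' ord_max z = col' ord_max x
  & z 0 ord_max = height f x].
Proof.
exists (- f (col' ord_max x) *: delta_mx 0 ord_max + x); split.
- by rewrite /shear col'_id addrC addrA -scalerDl subrr scale0r add0r.
- exact: col'_id.
- by rewrite !mxE !eqxx mulr1 addrC.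
Qed.

Lemma shear_continuous z :
  {for col' ord_max z, continuous f} -> {for z, continuous shear}.
Proof.
move=> cf; have cfc : {for z, continuous (f \o col' ord_max)}.
  by apply: continuous_comp cf; exact: col'_continuous.
apply: continuousD; first exact: cvg_id.
exact: (@continuousZr_tmp R _ _ _ (delta_mx 0 ord_max : 'rV[R]_m.+1) z cfc).
Qed.

End Shear.

Lemma ball_chart (R : realType) m (P z : 'rV[R]_m.+1) (r : R) :
  ball (col' ord_max P) r (col' ord_max z) -> `|P 0 ord_max - z 0 ord_max| < r ->
  ball P r z.
Proof.
move=> [r0 Pz] Pzn; split=> // i j; rewrite ord1.
case: (unliftP ord_max j) => [k ->|->] //.
by have := Pz 0 k; rewrite !mxE.
Qed.

(** The chart only says that [D] lies above the graph; that it
    contains all points above the graph near [P] comes from connectedness.  In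
    the sheared coordinates these points form a convex box, its image misses the
    boundary of [D], and it contains a point of [D] because [P] is in the
    closure. *)
Lemma domain_above_chart (R : realType) m (D U : set 'rV[R]_m.+1)
    (f : 'rV[R]_m -> R) (P : 'rV[R]_m.+1) :
  open D -> boundary D P -> boundary_chart D U f P ->
  \forall x \near P, 0 < height f x -> D x.
Proof.
move=> oD bP [[oU UP] f2 bU Dabove].
pose n := @ord_max m.
have hP : P 0 n = f (col' n P) by apply/eqP; rewrite -subr_eq0; apply/eqP/bU.
have cf x : U x -> {for col' n x, continuous f}.
  by move=> Ux; apply: (Ck_on_continuous f2); exists x.
have ch : {for P, continuous (height f)}.
  exact: Ck_on_continuous (Ck_on_height oU f2) UP.
have /nbhs_ballP[r /= r0 rU] : \forall x \near P, U x by exact: open_nbhs_nbhs.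
have r20 : 0 < r / 2 by rewrite divr_gt0.
have /cvgrPdist_lt/(_ _ r20)/nbhs_ballP[d /= d0 fd] := cf P UP.
have [p [p0 pr /ltW pd]] := small_radius r0 d0.
(* The box in sheared coordinates: p controls the first coordinates and the
   oscillation of f, and r / 2 the height, so that the image stays in U. *)
pose C (z : 'rV[R]_m.+1) :=
  [/\ ball (col' n P) p (col' n z), 0 < z 0 n & z 0 n < r / 2].
have CU z : C z -> U (shear f z).
  move=> [zp z0 zr]; apply: rU; apply: ball_chart.
    by rewrite col'_shear; exact: le_ball zp.
  rewrite shear_last hP; have := fd _ (le_ball pd zp).
  rewrite !ltr_norml -/n; move: (f _) (f _) (z _ _) z0 zr => a b s; lra.
have Nc : \forall x \near P, 0 < height f x ->
    exists2 z, C z & shear f z = x.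
  have : \forall x \near P, ball (col' n P) p (col' n x).
    by have := @col'_continuous R m n P; move/cvg_ballP; exact.
  have : \forall x \near P, `|height f P - height f x| < r / 2.
    by move/cvgrPdist_lt : ch; exact.
  apply: filterS2 => x hx xp x0; have [z [zx zc zn]] := shear_onto f x.
  exists z => //; split; rewrite ?zc ?zn//.
  by move: hx; rewrite /height -/n hP subrr sub0r normrN => /ltr_normlW.
have [y [Dy [Uy Ny]]] : D `&` (fun y => U y /\
    (0 < height f y -> exists2 z, C z & shear f z = y)) !=set0.
  by case: bP => cP _; apply: cP; apply: filterI Nc; exact: open_nbhs_nbhs.
have [a Ca ay] : exists2 z, C z & shear f z = y.
  by apply: Ny; rewrite subr_gt0; exact: Dabove.
apply: filterS Nc => x Nx /Nx[b Cb <-].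
pose g (t : R) : 'rV[R]_m.+1 := a + t *: (b - a).
have Cg t : t \in `[0, 1]%R -> C (g t).
  rewrite in_itv/= => /andP[t0 t1]; case: Ca Cb => [[_ ap] a0 ar] [[_ bp] b0 br].
  split.
  - split=> // i j; have := conv_dist_lt t0 t1 (ap i j) (bp i j).
    by rewrite /g !mxE ord1.
  - have := @conv_lt R (- a 0 n) (- b 0 n) 0 t t0 t1.
    rewrite !oppr_lt0 => /(_ a0 b0).
    rewrite !mxE -[X in _ -> is_true X]oppr_lt0.
    by congr (_ < _); ring.
  - by rewrite !mxE; exact: conv_lt.
pose A := (shear f \o g) @` `[0, 1].
have AD : A `<=` D.
  apply: connected_sub_open => //.
  - apply: connected_continuous_connected; first exact: segment_connected.
    apply: continuous_in_subspaceT => t; rewrite inE/= => t01.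
    apply: continuous_comp.
      apply: cvgD; first exact: cvg_cst.
      by apply: cvgZr_tmp; exact: cvg_id.
    apply: shear_continuous; rewrite -(col'_shear f); apply: cf; apply: CU.
    exact: Cg.
  - rewrite -subset0 => _ [[t t01 <-] bg]; have Ct := Cg t t01.
    have := (bU _ (CU _ Ct)).1 bg; rewrite -/(height f _) height_shear => g0.
    by case: Ct; rewrite g0 ltxx.
  - exists y; split=> //; exists 0; first by rewrite /= in_itv/= lexx ler01.
    by rewrite /= /g scale0r addr0.
apply: AD; exists 1; first by rewrite /= in_itv/= lexx ler01.
by rewrite /= /g scale1r subrKC.
Qed.

(** * Comparison with the barrier *)

Lemma within_cvg (T U : topologicalType) (A : set T) (g : T -> U) (x : T) :
  A x -> {within A, continuous g} -> g y @[y --> within A (nbhs x)] --> g x.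
Proof. by move=> Ax /subspace_continuousP; exact. Qed.

Lemma cvg_sumr (R : realType) (T I : Type) (F : set_system T) (r : seq I)
    (g : I -> T -> R) (l : I -> R) :
  Filter F -> (forall i, g i x @[x --> F] --> l i) ->
  \sum_(i <- r) g i x @[x --> F] --> \sum_(i <- r) l i.
Proof.
by move=> FF gl; apply: cvg_big => //; exact: (@add_continuous R^o).
Qed.

Lemma operator_cvg (R : realType) n (D U : set 'rV[R]_n)
    (a : 'I_n -> 'I_n -> 'rV[R]_n -> R) (b : 'I_n -> 'rV[R]_n -> R)
    (c : 'rV[R]_n -> R) (P : 'rV[R]_n) (h : 'rV[R]_n -> R) :
  closure D P -> U P -> Ck_on 2 U h ->
  (forall i j, {within closure D, continuous (a i j)}) ->
  (forall i, {within closure D, continuous (b i)}) ->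
  {within closure D, continuous c} ->
  diff_op a b c h x @[x --> within (closure D) (nbhs P)] --> diff_op a b c h P.
Proof.
move=> DP UP h2 ca cb cc.
have [ch dh] := h2.
have w (g : 'rV[R]_n -> R) : {for P, continuous g} ->
    g x @[x --> within (closure D) (nbhs P)] --> g P.
  by move=> cg; exact: cvg_within_filter.
apply: cvgD.
  apply: cvgD; apply: cvg_sumr => i.
    apply: cvg_sumr => j; apply: cvgM; first exact: within_cvg.
    apply: w; have [_ [_ dhj]] := dh j; have [_ [chij _]] := dhj i; exact: chij.
  apply: cvgM; first exact: within_cvg.
  by apply: w; have [_ [chi _]] := dh i; exact: chi.
by apply: cvgM; [exact: within_cvg|apply: w; exact: ch].
Qed.

(** The weak maximum principle at a single point: the first order
    part vanishes, and the second order part contracts [a] with a positive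
    semidefinite Hessian. *)
Lemma interior_min_operator (R : realType) n (O : set 'rV[R]_n)
    (a : 'I_n -> 'I_n -> 'rV[R]_n -> R) (b : 'I_n -> 'rV[R]_n -> R)
    (w : 'rV[R]_n -> R) (x : 'rV[R]_n) :
  open O -> Ck_on 2 O w -> O x -> (\forall y \near x, w x <= w y) ->
  (forall xi : 'rV[R]_n,
     0 <= \sum_(i < n) \sum_(j < n) a i j x * xi 0 i * xi 0 j) ->
  0 <= diff_op a b (cst 0) w x.
Proof.
move=> oO w2 Ox wm a0.
rewrite /diff_op mul0r addr0 [X in _ + X]big1 ?addr0; last first.
  by move=> i _; rewrite (local_min_gradient0 i (Ck_on_pred w2) Ox wm) mulr0.
pose A := \matrix_(i, j) a i j x; pose H := \matrix_(i, j) partial2 i j w x.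
have -> : \sum_(i < n) \sum_(j < n) a i j x * partial2 i j w x =
    \sum_(i < n) \sum_(j < n) A i j * H i j.
  by apply: eq_bigr => i _; apply: eq_bigr => j _; rewrite !mxE.
apply: psd_contraction_ge0 => [y||y].
- rewrite bilinE; under eq_bigr do under eq_bigr do rewrite mxE.
  exact: a0.
- by apply/matrixP => i j; rewrite !mxE; exact: partial2C w2 Ox.
- rewrite bilinE; have := local_min_hessian_ge0 y oO w2 Ox wm.
  by under [X in _ -> _ <= X]eq_bigr do under eq_bigr do rewrite mxE.
Qed.

(** The maximum principle for [w = u - e * h - u P] on the closure
    of [D] intersected with a small closed ball around [P]. *)
Lemma barrier_comparison (R : realType) n (D U : set 'rV[R]_n)
    (a : 'I_n -> 'I_n -> 'rV[R]_n -> R) (b : 'I_n -> 'rV[R]_n -> R)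
    (c : 'rV[R]_n -> R) (P : 'rV[R]_n) (u h : 'rV[R]_n -> R) :
  open D -> closure D P -> open U -> U P ->
  Ck_on 2 U h -> h P = 0 -> (forall x, U x -> boundary D x -> h x = 0) ->
  degenerate_elliptic D a ->
  (forall i j, {within closure D, continuous (a i j)}) ->
  (forall i, {within closure D, continuous (b i)}) ->
  {within closure D, continuous c} ->
  0 < diff_op a b c h P ->
  Ck_on 2 D u -> {within closure D, continuous u} -> strict_min_at D u P ->
  (forall x, D x -> diff_op a b c u x <= 0) ->
  (forall x, U x -> closure D x -> c x <= 0) ->
  (forall x, U x -> closure D x -> 0 <= c x * u P) ->
  exists2 e, 0 < e & \forall x \near P, D x -> u P + e * h x <= u x.
Proof.
move=> oD DP oU UP h2 hP hb ell ca cb cc LhP u2 cu um Lu c0 cuP.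
have ch x : U x -> {for x, continuous h}.
  by move=> Ux; exact: Ck_on_continuous h2 Ux.
have [r r0 Hr] : exists2 r, 0 < r & forall x, `|P - x| <= r ->
    [/\ U x, `|h x| <= 1 & closure D x -> 0 < diff_op a b c h x].
  have LhD : \forall x \near P, closure D x -> 0 < diff_op a b c h x.
    have := operator_cvg DP UP h2 ca cb cc; move/cvgr_gt => /(_ _ LhP).
    by rewrite near_withinE.
  have h1 : \forall x \near P, `|h x| <= 1.
    move/cvgrPdist_le : (ch _ UP) => /(_ 1 ltr01).
    by apply: filterS => x; rewrite hP sub0r normrN.
  have nU : \forall x \near P, U x by exact: open_nbhs_nbhs.
  have /nbhs_normP[d /= d0 Hd] : \forall x \near P,
      [/\ U x, `|h x| <= 1 & closure D x -> 0 < diff_op a b c h x].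
    by apply: filterS3 nU h1 LhD => x; exact: And3.
  exists (d / 2); first by rewrite divr_gt0.
  move=> x xP; apply: Hd.
  by rewrite /ball_/= (le_lt_trans xP)// ltr_pdivrMr// ltr_pMr// ltr1n.
pose K := closure D `&` [set x | `|P - x| <= r].
have Kbd (A : set 'rV[R]_n) : A `<=` K -> closed A -> compact A.
  move=> AK Ac; apply: bounded_closed_compact => //.
  exists (`|P| + r); split; first exact: num_real.
  move=> M rM x /AK[_ /= xr]; apply: le_trans (ltW rM).
  by rewrite -[x](subKr P) (le_trans (ler_normB _ _))// lerD2l.
have clK : closed K.
  by apply: closedI; [exact: closed_closure|exact: closed_closed_ball_].
have cK : compact K by exact: Kbd.
have [d d0 Hd] : exists2 d, 0 < d &
    forall x, closure D x -> `|P - x| = r -> u P + d <= u x.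
  pose S := K `&` ~` ball P r.
  have Sin x : closure D x -> `|P - x| = r -> S x.
    move=> Dx xr; split; first by split=> //=; rewrite xr.
    by rewrite -ball_normE /ball_/= xr ltxx.
  have cS : compact S.
    apply: Kbd; first exact: subIsetl.
    by apply: closedI; last exact/open_closedC/ball_open.
  have [S0|/set0P/negP/negPn/eqP S0] := pselect (S !=set0); last first.
    by exists 1 => // x Dx xr; have := Sin x Dx xr; rewrite S0.
  have [|y yS ymin] := compact_EVT_min S0 cS (f := u).
    by apply: continuous_subspaceW cu => x [[]].
  move/set_mem : yS => [[Dy /= _] yr].
  exists (u y - u P).
    by rewrite subr_gt0; apply: um => // yP; apply: yr; rewrite yP; exact: ballxx.
  by move=> x Dx xr; rewrite subrKC; apply: ymin; exact/mem_set/Sin.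
(* Since `|h| <= 1 on K, the gap d on the sphere also serves as the factor e. *)
exists d => //.
pose w x := 1 * u x + (- d) * h x + (- u P).
have wE x : w x = u x - u P - d * h x by rewrite /w; ring.
suff Kw x : K x -> 0 <= w x.
  apply/nbhs_normP; exists r => // x /ltW xr Dx.
  by have := Kw x (conj (subset_closure Dx) xr); rewrite wE; lra.
have PK : K P by split=> //=; rewrite subrr normr0 ltW.
have cw : {within K, continuous w}.
  move=> y; apply: continuous_lin.
    by apply: (continuous_subspaceW _ cu) => z [].
  apply: continuous_in_subspaceT => z /set_mem[_ zr].
  by apply: ch; have [] := Hr _ zr.
have [y /set_mem[Dy yr] ymin] := compact_EVT_min (ex_intro _ P PK) cK cw.
move=> Kx; apply: le_trans (ymin _ (mem_set Kx)).
rewrite leNgt; apply/negP => wy.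
have uPy : u P <= u y.
  by have [->//|yP] := eqVneq y P; apply/ltW/um => //; exact/eqP.
have [Uy hy Lhy] := Hr _ yr.
have Diy : D y.
  apply: contrapT => nDy; move: wy; rewrite wE (hb y Uy) ?mulr0; first by lra.
  by split=> //; rewrite ((interior_id D).1 oD).
have {}yr : `|P - y| < r.
  rewrite lt_neqAle yr andbT; apply/eqP => yrE.
  have := Hd _ Dy yrE; have : d * h y <= d.
    by rewrite ger_pMr// (le_trans (ler_norm _)).
  by move: wy; rewrite wE; lra.
pose O := D `&` U.
have oO : open O by exact: openI.
have Oy : O y by [].
have u2O : Ck_on 2 O u by apply: Ck_on_sub u2; exact: subIsetl.
have h2O : Ck_on 2 O h by apply: Ck_on_sub h2; exact: subIsetr.
have w2 : Ck_on 2 O w by exact: Ck_on_lin.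
have wm : \forall z \near y, w y <= w z.
  have nD : \forall z \near y, D z by exact: open_nbhs_nbhs.
  have nr : \forall z \near y, `|P - z| < r.
    have : \forall z \near y, ball P r z.
      by apply: open_nbhs_nbhs; split; [exact: ball_open|rewrite -ball_normE].
    by rewrite -ball_normE.
  apply: filterS2 nD nr => z Dz zr; apply: ymin; apply/mem_set; split.
    exact: subset_closure.
  exact: ltW.
have := interior_min_operator b oO w2 Oy wm (ell _ Diy).
rewrite /w (diff_op_lin _ _ _ _ _ _ oO u2O h2O Oy) mul0r addr0 mul1r.
have diff_opD v : diff_op a b c v y = diff_op a b (cst 0) v y + c y * v y.
  by rewrite /diff_op mul0r addr0.
have := Lu _ Diy; have := Lhy Dy; rewrite !diff_opD.
have cy := c0 _ Uy Dy; have cPy := cuP _ Uy Dy.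
have cw0 : 0 <= c y * w y by rewrite mulr_le0// ltW.
move: (diff_op a b (cst 0) h y) (diff_op a b (cst 0) u y) => Lh0 Lu0 Lh1 Lu1 Lw1.
have H1 : 0 < d * Lh0 + d * (c y * h y) by rewrite -mulrDr mulr_gt0.
have H2 : c y * w y = c y * u y - c y * u P - d * (c y * h y).
  by rewrite wE; ring.
rewrite H2 in cw0; rewrite mulNr in Lw1; lra.
Qed.

(** * From the barrier to the slope at the boundary *)

(** Proves that the limit in the definition of the gradient on the
    closure exists, so that it can be computed. *)
Lemma grad_closure_cvg (R : realType) n (D : set 'rV[R]_n) (u : 'rV[R]_n -> R)
    (P : 'rV[R]_n) (i : 'I_n) :
  C1_closure D u -> closure D P ->
  partial i u y @[y --> within D (nbhs P)] --> grad_closure D u P 0 i.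
Proof.
move=> [_ _ /(_ i)[g cg gE]] DP; rewrite mxE.
have PF : ProperFilter (within D (nbhs P)) by exact: within_nbhs_proper.
suff H : partial i u y @[y --> within D (nbhs P)] --> g P.
  by rewrite (cvg_lim _ H).
have H : g y @[y --> within D (nbhs P)] --> g P.
  apply: cvg_trans (within_cvg DP cg); apply: cvg_app.
  by apply: within_subset; exact: subset_closure.
apply: cvg_trans H; apply: near_eq_cvg.
apply: (@filterE _ (nbhs P)) => y Dy; exact: gE.
Qed.

Lemma within_continuous_comp_sub (T U V : topologicalType) (A : set T)
    (B : set U) (f : T -> U) (g : U -> V) :
  continuous f -> (forall x, A x -> B (f x)) -> {within B, continuous g} ->
  {within A, continuous (fun x => g (f x))}.
Proof.
move=> cf AB cg; apply/subspace_continuousP => x Ax.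
apply: (@cvg_comp _ _ _ f g _ (within B (nbhs (f x)))); last first.
  exact: (@within_cvg _ _ B g (f x) (AB x Ax) cg).
move=> C BC; have Bx : nbhs x (fun y => B (f y) -> C (f y)) := cf x _ BC.
suff : nbhs x (fun y => A y -> C (f y)) by [].
by apply: filterS Bx => y BCy Ay; exact: BCy (AB y Ay).
Qed.

(** If the derivative of [u] along [v] were not positive at [P], then
    just inside [D] it would be smaller than the rate at which [e * h], and
    hence [u], is known to grow along the ray from [P]. *)
Lemma slope_at_boundary (R : realType) n (D U : set 'rV[R]_n)
    (P v : 'rV[R]_n) (u h : 'rV[R]_n -> R) (e : R) :
  open D -> closure D P -> open U -> U P -> Ck_on 1 U h -> h P = 0 ->
  (\forall x \near P, 0 < h x -> D x) ->
  0 < \sum_(i < n) v 0 i * partial i h P ->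
  C1_closure D u -> 0 < e ->
  (\forall x \near P, D x -> u P + e * h x <= u x) ->
  0 < dir_deriv D u v P.
Proof.
move=> oD DP oU UP h1 hP hD; set N := \sum_i _ => N0 u1 e0 ue.
have N20 : 0 < N / 2 by rewrite divr_gt0.
rewrite ltNge; apply/negP => d0.
(* W is the derivative of u along v inside D.  Along the ray, e * h grows at
   rate e * N; half of it leaves room for the approximations. *)
pose W x := \sum_(i < n) v 0 i * partial i u x.
have cW : W x @[x --> within D (nbhs P)] --> dir_deriv D u v P.
  apply: cvg_sumr => i; apply: cvgM; first exact: cvg_cst.
  exact: grad_closure_cvg.
have nW : \forall x \near P, D x -> W x < e * (N / 2).
  have := cvgr_lt _ cW (e * (N / 2)); rewrite near_withinE; apply.
  by rewrite (le_lt_trans d0)// mulr_gt0.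
have [s s0 Hs] := small_segment v (filterI hD (filterI ue nW)).
have hv : \forall t \near (0 : R), t * (N / 2) <= h (P + t *: v) \/ t <= 0.
  have := is_derive_sum_partial v oU h1 UP.
  move=> /is_derive_affineP/(_ _ N20); apply: filterS => t.
  rewrite hP subr0 -/N; have [|t0] := leP t 0; first by right.
  rewrite (gtr0_norm t0) ler_norml => /andP[H _]; left.
  have E : t * N = N / 2 * t + t * (N / 2) by field.
  by rewrite E in H; lra.
have /nbhs_normP[r0 /= r00 Hr0] := hv.
have [r [r_gt0 rs rr0]] := small_radius s0 r00.
have hr (t : R) : 0 < t -> t <= r -> t * (N / 2) <= h (P + t *: v).
  move=> t0 tr; have [|//|] := Hr0 t.
    by rewrite /ball_/= sub0r normrN gtr0_norm// (le_lt_trans tr).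
  by rewrite leNgt t0.
have Ht (t : R) : 0 < t -> t <= r -> D (P + t *: v) /\
    (u P + e * h (P + t *: v) <= u (P + t *: v) /\
     W (P + t *: v) < e * (N / 2)).
  move=> t0 tr; have [HD [Hu HW]] : (0 < h (P + t *: v) -> D (P + t *: v)) /\
      ((D (P + t *: v) -> u P + e * h (P + t *: v) <= u (P + t *: v)) /\
       (D (P + t *: v) -> W (P + t *: v) < e * (N / 2))).
    by apply: Hs; rewrite gtr0_norm// (le_trans tr).
  have Dt : D (P + t *: v).
    by apply: HD; rewrite (lt_le_trans _ (hr t t0 tr))// mulr_gt0.
  by split=> //; split; [exact: Hu|exact: HW].
pose g (t : R) := u (P + t *: v).
have dg (t : R) : t \in `]0, r[%R -> is_derive t 1 g (W (P + t *: v)).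
  rewrite in_itv/= => /andP[t0 tr]; have [Dt _] := Ht t t0 (ltW tr).
  have [C1u _ _] := u1.
  have [du dE] := is_derive_sum_partial v oD C1u Dt.
  have -> : W (P + t *: v) = 'D_v u (P + t *: v) by rewrite dE.
  exact: is_derive_line du.
have cg : {within `[0, r], continuous g}.
  have [_ cu _] := u1.
  have cl : continuous (fun t : R => P + t *: v).
    move=> t; apply: cvgD; first exact: cvg_cst.
    by apply: cvgZr_tmp; exact: cvg_id.
  apply: (within_continuous_comp_sub cl _ cu) => t /=.
  rewrite in_itv/= le_eqVlt => /andP[/predU1P[<- _|t0 tr]].
    by rewrite scale0r addr0.
  by apply: subset_closure; have [] := Ht t t0 tr.
have [t tr E] := MVT r_gt0 dg cg.
move: tr; rewrite in_itv/= => /andP[t0 tr].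
have [_ [_ Wt]] := Ht t t0 (ltW tr).
have [_ [ur _]] := Ht r r_gt0 (lexx r).
have hrr := hr r r_gt0 (lexx r).
move: E; rewrite /g scale0r addr0 subr0 => E.
have A : W (P + t *: v) * r < e * (N / 2) * r by rewrite ltr_pM2r.
have B : e * (r * (N / 2)) <= e * h (P + r *: v) by rewrite ler_pM2l.
have F : e * (N / 2) * r = e * (r * (N / 2)) by ring.
by rewrite F -E in A; lra.
Qed.

(** * The two signs *)

Lemma opp_lin (R : realType) (T : Type) (u : T -> R) :
  (fun x => - u x) = (fun x => - 1 * u x + 0 * u x + 0).
Proof. by apply/funext => x; ring. Qed.

Lemma Ck_on_opp (R : realType) n k (O : set 'rV[R]_n) (u : 'rV[R]_n -> R) :
  open O -> Ck_on k O u -> Ck_on k O (fun x => - u x).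
Proof. by rewrite opp_lin => oO u1; exact: Ck_on_lin. Qed.

Lemma partial_opp (R : realType) n (O : set 'rV[R]_n) (u : 'rV[R]_n -> R)
    (i : 'I_n) (x : 'rV[R]_n) :
  Ck_on 1 O u -> O x -> partial i (fun y => - u y) x = - partial i u x.
Proof.
by move=> u1 Ox; rewrite opp_lin (partial_lin _ _ _ _ u1 u1 Ox) mulN1r mul0r addr0.
Qed.

Lemma diff_op_opp (R : realType) n (O : set 'rV[R]_n)
    (a : 'I_n -> 'I_n -> 'rV[R]_n -> R) (b : 'I_n -> 'rV[R]_n -> R)
    (c u : 'rV[R]_n -> R) (x : 'rV[R]_n) :
  open O -> Ck_on 2 O u -> O x ->
  diff_op a b c (fun y => - u y) x = - diff_op a b c u x.
Proof.
move=> oO u2 Ox; rewrite opp_lin (diff_op_lin _ _ _ _ _ _ oO u2 u2 Ox).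
by rewrite mulN1r mul0r mulr0 !addr0.
Qed.

Lemma C1_closure_opp (R : realType) n (D : set 'rV[R]_n) (u : 'rV[R]_n -> R) :
  open D -> C1_closure D u -> C1_closure D (fun x => - u x).
Proof.
move=> oD [u1 cu gu]; split.
- exact: Ck_on_opp.
- by move=> x; apply: cvgN; exact: cu.
move=> i; have [g cg gE] := gu i; exists (fun x => - g x).
  by move=> x; apply: cvgN; exact: cg.
by move=> x Dx; rewrite gE// (partial_opp i u1 Dx).
Qed.

Lemma dir_deriv_opp (R : realType) n (D : set 'rV[R]_n) (u : 'rV[R]_n -> R)
    (v P : 'rV[R]_n) :
  open D -> closure D P -> C1_closure D u ->
  dir_deriv D (fun x => - u x) v P = - dir_deriv D u v P.
Proof.
move=> oD DP u1; rewrite /dir_deriv -sumrN; apply: eq_bigr => i _.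
rewrite -mulrN; congr (_ * _).
have PF : ProperFilter (within D (nbhs P)) by exact: within_nbhs_proper.
have H := grad_closure_cvg (i := i) (C1_closure_opp oD u1) DP.
have [C1u _ _] := u1.
have N : - partial i u y @[y --> within D (nbhs P)] --> - grad_closure D u P 0 i.
  exact: cvgN (grad_closure_cvg (i := i) u1 DP).
suff H' : partial i (fun x => - u x) y
    @[y --> within D (nbhs P)] --> - grad_closure D u P 0 i.
  by apply: (cvg_unique _ H H').
apply: cvg_trans N; apply: near_eq_cvg.
by apply: (@filterE _ (nbhs P)) => y Dy; rewrite (partial_opp i C1u Dy).
Qed.

(** The sign condition [0 <= c * u P] serves both the case [c = 0]
    and the case [c <= 0] with [u P <= 0]. *)
Lemma strict_min_slope (R : realType) (m : nat) (D : set 'rV[R]_m.+1)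
  (a : 'I_m.+1 -> 'I_m.+1 -> 'rV[R]_m.+1 -> R)
  (b : 'I_m.+1 -> 'rV[R]_m.+1 -> R)
  (c : 'rV[R]_m.+1 -> R)
  (P : 'rV[R]_m.+1) (U : set 'rV[R]_m.+1) (f : 'rV[R]_m -> R)
  (u : 'rV[R]_m.+1 -> R) :
  open D -> degenerate_elliptic D a ->
  (forall i j, {within closure D, continuous (a i j)}) ->
  (forall i, {within closure D, continuous (b i)}) ->
  {within closure D, continuous c} ->
  boundary D P -> boundary_chart D U f P ->
  0 < - (\sum_(i < m) b (lift ord_max i) P * partial i f (col' ord_max P))
      + b ord_max P
      - \sum_(i < m) \sum_(j < m)
          a (lift ord_max i) (lift ord_max j) P
          * partial2 i j f (col' ord_max P) ->
  Ck_on 2 D u -> C1_closure D u ->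
  (forall x, U x -> closure D x -> c x <= 0) ->
  (forall x, U x -> closure D x -> 0 <= c x * u P) ->
  strict_min_at D u P -> (forall x, D x -> diff_op a b c u x <= 0) ->
  0 < dir_deriv D u (graph_normal f P) P.
Proof.
move=> oD ell ca cb cc bP chart LhP u2 u1 c0 cuP um Lu.
have DP : closure D P by case: bP.
have [[oU UP] f2 bU _] := chart.
have hP : height f P = 0 by exact/bU.
have h2 := Ck_on_height oU f2.
have Lh : 0 < diff_op a b c (height f) P.
  rewrite /diff_op hP mulr0 addr0.
  by rewrite (operator_height oU f2 (fun i j => a i j P) (fun i => b i P) UP).
have hb x : U x -> boundary D x -> height f x = 0 by move=> Ux /bU; exact.
have [_ cu _] := u1.
have [e e0 ue] := barrier_comparison oD DP oU UP h2 hP hb ell ca cb cc Lh u2 cu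
  um Lu c0 cuP.
apply: (slope_at_boundary oD DP oU UP (Ck_on_pred h2) hP _ _ u1 e0 ue).
  exact: domain_above_chart oD bP chart.
under eq_bigr do rewrite (partial_height f2 _ UP).
rewrite sum_ord_max mxE unlift_none mulr1 ltr_pwDl// sumr_ge0// => i _.
by rewrite -expr2 sqr_ge0.
Qed.

Theorem theorem2p1 (R : realType) (m : nat) (D : set 'rV[R]_m.+1)
  (a : 'I_m.+1 -> 'I_m.+1 -> 'rV[R]_m.+1 -> R)
  (b : 'I_m.+1 -> 'rV[R]_m.+1 -> R)
  (c : 'rV[R]_m.+1 -> R)
  (P : 'rV[R]_m.+1) (U : set 'rV[R]_m.+1) (f : 'rV[R]_m -> R)
  (u : 'rV[R]_m.+1 -> R) :
  is_domain D -> bounded_set D -> C2_boundary D ->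
  degenerate_elliptic D a ->
  (forall i j, bounded_continuous_on (closure D) (a i j)) ->
  (forall i, bounded_continuous_on (closure D) (b i)) ->
  bounded_continuous_on (closure D) c ->
  boundary D P -> boundary_chart D U f P ->
  0 < - (\sum_(i < m) b (lift ord_max i) P * partial i f (col' ord_max P))
      + b ord_max P
      - \sum_(i < m) \sum_(j < m)
          a (lift ord_max i) (lift ord_max j) P
          * partial2 i j f (col' ord_max P) ->
  Ck_on 2 D u -> C1_closure D u ->
  ((forall x, U x -> closure D x -> c x = 0) ->
     (strict_min_at D u P -> (forall x, D x -> diff_op a b c u x <= 0) ->
        0 < dir_deriv D u (graph_normal f P) P) /\
     (strict_max_at D u P -> (forall x, D x -> 0 <= diff_op a b c u x) ->
        dir_deriv D u (graph_normal f P) P < 0)) /\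
  ((forall x, U x -> closure D x -> c x <= 0) ->
     (strict_min_at D u P -> (forall x, D x -> diff_op a b c u x <= 0) ->
        u P <= 0 ->
        0 < dir_deriv D u (graph_normal f P) P) /\
     (strict_max_at D u P -> (forall x, D x -> 0 <= diff_op a b c u x) ->
        0 <= u P ->
        dir_deriv D u (graph_normal f P) P < 0)).
Proof.
move=> [oD _ _] _ _ ell ca cb cc bP chart LhP u2 u1.
have slope v := @strict_min_slope R m D a b c P U f v oD ell
  (fun i j => (ca i j).2) (fun i => (cb i).2) cc.2 bP chart LhP.
have minE := slope u u2 u1.
have maxE : (forall x, U x -> closure D x -> c x <= 0) ->
    (forall x, U x -> closure D x -> c x * u P <= 0) ->
    strict_max_at D u P -> (forall x, D x -> 0 <= diff_op a b c u x) ->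
    dir_deriv D u (graph_normal f P) P < 0.
  move=> c0 cuP uM Lu; have DP : closure D P by case: bP.
  rewrite -oppr_gt0 -(dir_deriv_opp _ oD DP u1); apply: slope.
  - exact: Ck_on_opp.
  - exact: C1_closure_opp.
  - exact: c0.
  - by move=> x Ux Dx; rewrite mulrN oppr_ge0 cuP.
  - by move=> x Dx xP; rewrite ltrN2 uM.
  - by move=> x Dx; rewrite (diff_op_opp _ _ _ oD u2 Dx) oppr_le0 Lu.
split=> [c0|c0].
  have c0' x : U x -> closure D x -> c x <= 0 by move=> Ux Dx; rewrite c0.
  split=> [um Lu|uM Lu].
    by apply: minE => // x Ux Dx; rewrite c0// mul0r.
  by apply: maxE => // x Ux Dx; rewrite c0// mul0r.
split=> [um Lu uP|uM Lu uP].
  by apply: minE => // x Ux Dx; rewrite mulr_le0// c0.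
by apply: maxE => // x Ux Dx; rewrite mulr_le0_ge0// c0.
Qed.
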